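(* For every integer $n\ge1$ and $m\ge0$, \[ (-1)^n\frac{\mathcal{C}_{n,m}^{(k)}(a,q,L)}{n!}=\sum_{i=1}^{n}q^{n-i}\binom{n-1}{i-1}\frac{\widehat{\mathcal{C}}_{i,m}^{(k)}(a,q,L)}{i!},\qquad (-1)^n\frac{\widehat{\mathcal{C}}_{n,m}^{(k)}(a,q,L)}{n!}=\sum_{i=1}^{n}q^{n-i}\binom{n-1}{i-1}\frac{\mathcal{C}_{i,m}^{(k)}(a,q,L)}{i!}. \]
   Context: Let $k\ge1$ be an integer, $a,q,l_1,\dots,l_k$ nonzero reals, $L=(l_1,\dots,l_k)$, $l=\prod l_i$; denominators $a+j$ ($j\ge0$ integer) are assumed nonzero and $l^{a+i}$ means $l^a l^i$. Let $s(n,i)$ be the signed Stirling numbers of the first kind ($\frac{1}{i!}(\ln(1+x))^i=\sum_{n\ge i}s(n,i)\frac{x^n}{n!}$). Define \[ \mathcal{C}_{n,m}^{(k)}(a,q,L)=\frac{(a+m)^k}{a^k}\sum_{i=0}^{n}s(n,i)\frac{q^{n-i}l^{a+i}}{(a+i+m)^k},\qquad \widehat{\mathcal{C}}_{n,m}^{(k)}(a,q,L)=\frac{(a+m)^k}{a^k}\sum_{i=0}^{n}s(n,i)\frac{(-1)^iq^{n-i}l^{a+i}}{(a+i+m)^k}. \] *)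

(* Defs.v *)
From HB Require Import structures.
From mathcomp Require Import all_boot all_order all_algebra.
From mathcomp Require Import all_classical all_reals all_analysis.
From mathcomp Require Import complex.

Set Implicit Arguments.
Unset Strict Implicit.
Unset Printing Implicit Defensive.

Import Order.TTheory GRing.Theory Num.Theory.
Local Open Scope ring_scope.
Local Open Scope complex_scope.

(* The power series ln(1 + x) = \sum_(j >= 1) (-1)^(j-1) x^j / j, truncated
   after degree n. *)
Definition ln1p_trunc (F : fieldType) (n : nat) : {poly F} :=
  \sum_(1 <= j < n.+1) ((-1) ^+ j.-1 / j%:R) *: 'X^j.

(* s(n, i) / n! is the coefficient of x^n in (ln(1 + x))^i / i!; the terms of
   degree > n of ln(1 + x) do not contribute to that coefficient. *)
Definition stirling1 (F : fieldType) (n i : nat) : F :=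
  n`!%:R * ((i`!%:R)^-1 *: ln1p_trunc F n ^+ i)`_n.

Section PolyCauchy.
Variable R : realType.
Implicit Types (l a q : R) (n m k i : nat).

(* For l < 0 and non-integral a there is no canonical real value of l^a.
   The values of l^a are exp(a w), w ranging over the complex logarithms
   ln|l| + i (arg l + 2 pi b), b an integer, of l (l != 0).  For l > 0 and
   b = 0 this is the usual real power, see cpow_pos. *)
Definition cpow (b : int) (l a : R) : R[i] :=
  let t := a * ((if l < 0 then pi else 0) + 2 * pi * b%:~R) in
  (`|l| `^ a * cos t) +i* (`|l| `^ a * sin t).

Lemma cpow_pos l a : 0 < l -> cpow 0 l a = (l `^ a)%:C.
Proof.
move=> l0; rewrite /cpow ltNge (ltW l0) /= mulr0 addr0 mulr0 cos0 sin0.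
by rewrite mulr1 mulr0 gtr0_norm.
Qed.

Definition lprod k (L : k.-tuple R) : R := \prod_(i < k) tnth L i.

(* C_{n,m}^(k)(a,q,L), where l^(a + i) stands for l^a * l^i and b selects the
   value of l^a. *)
Definition polyCauchy1 (b : int) k (a q : R) (L : k.-tuple R) n m : R[i] :=
  ((a + m%:R) ^+ k / a ^+ k)%:C *
  \sum_(0 <= i < n.+1)
    (stirling1 R n i * q ^+ (n - i))%:C * (cpow b (lprod L) a * (lprod L)%:C ^+ i)
    / ((a + i%:R + m%:R) ^+ k)%:C.

Definition polyCauchy2 (b : int) k (a q : R) (L : k.-tuple R) n m : R[i] :=
  ((a + m%:R) ^+ k / a ^+ k)%:C *
  \sum_(0 <= i < n.+1)
    (stirling1 R n i * ((-1) ^+ i * q ^+ (n - i)))%:C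
    * (cpow b (lprod L) a * (lprod L)%:C ^+ i)
    / ((a + i%:R + m%:R) ^+ k)%:C.

End PolyCauchy.

(* Main.v *)
Require Import Defs.
From HB Require Import structures.
From mathcomp Require Import all_boot all_order all_algebra.
From mathcomp Require Import all_classical all_reals all_analysis.
From mathcomp Require Import complex.
From mathcomp Require Import ring.

Import Order.TTheory GRing.Theory Num.Theory.
Local Open Scope ring_scope.
Local Open Scope complex_scope.

(** Up to exchanging the order of summation, both identities are the inversion
    [(-1)^n s(n,j) / n! = \sum_i 'C(n-1, i-1) (-1)^j s(i,j) / i!].  As
    [\sum_j s(n,j) y^j / n!] is the generalized binomial coefficient [y choose n],
    this compares coefficients of [y^j] in
    [(-1)^n (y choose n) = (-y + n - 1 choose n)
       = \sum_i 'C(n-1, i-1) (-y choose i)],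
    the second equality being Vandermonde's convolution. *)

Section StirlingGeneratingPolynomial.
Variable F : numFieldType.
Implicit Types (n i j N : nat) (e : F) (p y : {poly F}).

Lemma natrS_neq0 n : n.+1%:R != 0 :> F.
Proof. by rewrite pnatr_eq0. Qed.

Lemma coef_signM n p j : ((-1) ^+ n * p)`_j = (-1) ^+ n * p`_j.
Proof. by rewrite -(rmorph_sign (@polyC F)) mul_polyC coefZ. Qed.

Lemma coef_ln1p_trunc N n :
  (ln1p_trunc F N)`_n = if (0 < n <= N)%N then (-1) ^+ n.-1 / n%:R else 0.
Proof.
rewrite /ln1p_trunc coef_sum.
under eq_bigr do rewrite coefZ coefXn.
case: ifP => [/andP[n0 nN]|nN].
  rewrite (bigD1_seq n) ?iota_uniq ?mem_index_iota ?n0 //= eqxx mulr1.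
  by rewrite big1 ?addr0 // => i /negPf; rewrite eq_sym => ->; rewrite mulr0.
rewrite big_nat big1 // => i; rewrite ltnS => iN.
by case: eqP => [ni|]; rewrite ?mulr0 //; rewrite ni iN in nN.
Qed.

Lemma coef_exp_congr p1 p2 n i :
  (forall j, (j <= n)%N -> p1`_j = p2`_j) -> (p1 ^+ i)`_n = (p2 ^+ i)`_n.
Proof.
move=> eq_p; elim: i n eq_p => [//|i IH] n eq_p.
rewrite !exprS !coefM; apply: eq_bigr => -[j /=].
rewrite ltnS => jn _; rewrite eq_p // IH // => h hn; apply: eq_p.
by rewrite (leq_trans hn) // leq_subr.
Qed.

(** The coefficient of $x^n$ in $\ln(1+x)^i/i!$, so that no factorial enters the recurrence and the
    inversion. *)
Definition logcoef n i : F := stirling1 F n i / n`!%:R.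

(** Frees the truncation degree from [n], so that one polynomial serves the indices [n] and [n.+1]
    together in the recurrence. *)
Lemma logcoefE N n i : (n <= N)%N ->
  logcoef n i = (i`!%:R)^-1 * (ln1p_trunc F N ^+ i)`_n.
Proof.
move=> nN; rewrite /logcoef /stirling1 coefZ mulrC.
rewrite mulKf ?pnatr_eq0 -?lt0n ?fact_gt0 //.
congr (_ * _); apply: coef_exp_congr => j jn; rewrite !coef_ln1p_trunc jn.
by rewrite (leq_trans jn nN).
Qed.

(** Truncated form of $(1+x)\ln(1+x)'=1$: the derivative is a finite geometric sum, and the error
    sits in degree [N]. *)
Lemma deriv_ln1p_trunc N : (1 + 'X) * (ln1p_trunc F N)^`() = 1 - (- 'X) ^+ N.
Proof.
have -> : (ln1p_trunc F N)^`() = \sum_(i < N) (- 'X) ^+ i.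
  apply/polyP => i; rewrite coef_deriv coef_ln1p_trunc /= coef_sum.
  under eq_bigr do rewrite exprNn coef_signM coefXn.
  case: ifP => iN.
    rewrite (bigD1 (Ordinal iN)) //= eqxx mulr1 big1 ?addr0.
      by rewrite -[LHS]mulr_natr divfK ?natrS_neq0.
    move=> j; rewrite -val_eqE /= => /negPf; rewrite eq_sym => ->.
    by rewrite mulr0.
  rewrite mul0rn big1 // => j _; case: eqP => [ij|]; rewrite ?mulr0 //.
  by rewrite ij ltn_ord in iN.
by rewrite -[X in X - _](expr1n _ N) subrXX opprK; congr (_ * _);
  apply: eq_bigr => i _; rewrite expr1n mul1r.
Qed.

Lemma logcoef0 n : logcoef n 0 = (n == 0)%:R.
Proof. by rewrite (@logcoefE n) // expr0 coef1 fact0 invr1 mul1r. Qed.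

Lemma logcoef0S i : logcoef 0 i.+1 = 0.
Proof. by rewrite (@logcoefE 0) // /ln1p_trunc big_geq // expr0n coef0 mulr0. Qed.

(* The differential equation (1 + x) (u^(i+1) / (i+1)!)' = u^i / i! for
   u = ln(1 + x). *)
Lemma logcoefS n i :
  n.+1%:R * logcoef n.+1 i.+1 = logcoef n i - n%:R * logcoef n i.+1.
Proof.
rewrite !(@logcoefE n.+1) //; set u := ln1p_trunc F n.+1.
(* Truncating at [n.+1] puts the error in degree at least [n.+1], so it is invisible in the
   coefficient of degree [n] read off next. *)
have eq_deriv : (u ^+ i.+1)^`() * (1 + 'X) =
    (u ^+ i - u ^+ i * (-1) ^+ n.+1 * 'X^(n.+1)) *+ i.+1.
  rewrite deriv_exp /= mulrnAl mulrAC [_ * (1 + 'X)]mulrC deriv_ln1p_trunc.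
  by rewrite mulrC mulrBr mulr1 [(- 'X) ^+ _]exprNn mulrA.
have {eq_deriv} := congr1 (fun p : {poly F} => p`_n) eq_deriv.
rewrite mulrDr mulr1 coefD coefMX coefMn coefB coefMXn ltnSn subr0 !coef_deriv.
have -> : (if n == 0 then 0 else (u ^+ i.+1)`_n.-1.+1 *+ n.-1.+1) =
    (u ^+ i.+1)`_n *+ n by case: (n).
move=> eq_coef.
have i0 : i`!%:R != 0 :> F by rewrite pnatr_eq0 -lt0n fact_gt0.
have iS0 := natrS_neq0 i.
rewrite factS natrM invfM.
have -> : (u ^+ i)`_n =
    ((u ^+ i.+1)`_n.+1 * n.+1%:R + (u ^+ i.+1)`_n * n%:R) / i.+1%:R.
  by rewrite !mulr_natr eq_coef -[X in X / _]mulr_natr mulfK.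
by field; rewrite i0 addrC natr1.
Qed.

(** The generalized binomial coefficient $\binom{y}{n}$; a polynomial argument lets [- 'X] and its
    shifts be substituted directly. *)
Definition genbin n y : {poly F} :=
  (n`!%:R)^-1 *: \prod_(i < n) (y - i%:R).

Lemma genbin0 y : genbin 0 y = 1.
Proof. by rewrite /genbin big_ord0 fact0 invr1 scale1r. Qed.

Lemma genbinS n y : n.+1%:R *: genbin n.+1 y = (y - n%:R) * genbin n y.
Proof.
rewrite /genbin big_ord_recr /= factS natrM invfM !scalerA.
by rewrite mulrA divff ?natrS_neq0 // mul1r -scalerAr mulrC.
Qed.

(** Multiplying by [e *: 'X - n%:R] acts on coefficients as the recurrence [logcoefS]. The scalar
    [e] covers both ['X] and [- 'X]. *)
Lemma coef_genbin e n j : (genbin n (e *: 'X))`_j = e ^+ j * logcoef n j.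
Proof.
elim: n j => [|n IH] j.
  rewrite genbin0 coef1; case: j => [|j]; rewrite ?logcoef0S ?mulr0 //.
  by rewrite logcoef0 expr0 mulr1.
apply: (mulfI (natrS_neq0 n)); rewrite -coefZ genbinS mulrBl coefB.
rewrite -scalerAl coefZ coefXM [n%:R * _]mulr_natl coefMn !IH.
case: j => [|j] /=.
  by case: n {IH} => [|n]; rewrite !logcoef0 /= !(mulr0, mulr0n, mul0rn, subrr).
by rewrite [RHS]mulrCA logcoefS -mulr_natl exprS; ring.
Qed.

Lemma genbin_pascal n y : genbin n.+1 (y + 1) = genbin n.+1 y + genbin n y.
Proof.
apply: (scalerI (natrS_neq0 n)); rewrite scalerDr !genbinS.
(* Both sides are the product of the factors [y + 1 - i] for [i <= n], up to $1/n!$, with the last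
   or the first factor split off. *)
suff shift : (y + 1 - n%:R) * genbin n (y + 1) = (y + 1) * genbin n y.
  by rewrite shift -mul_polyC rmorph_nat -natr1; ring.
rewrite /genbin -!scalerAr mulrC.
have -> : (\prod_(i < n) (y + 1 - i%:R)) * (y + 1 - n%:R) =
    \prod_(i < n.+1) (y + 1 - i%:R) by rewrite big_ord_recr.
rewrite big_ord_recl subr0; congr (_ *: (_ * _)).
by apply: eq_bigr => i _; rewrite lift0 -natr1; ring.
Qed.

(** Induction on [N]; the offset [r] is general because Pascal's rule calls the induction hypothesis
    at both [r] and [r.+1]. *)
Lemma genbin_vandermonde N r y :
  \sum_(i < N.+1) 'C(N, i)%:R *: genbin (r + i) y = genbin (r + N) (y + N%:R).
Proof.
elim: N r => [|N IH] r.
  by rewrite big_ord1 scale1r addn0 addr0.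
rewrite -natr1 addrA addnS genbin_pascal -IH -addSn -IH [RHS]addrC.
rewrite big_ord_recl bin0 scale1r addn0.
under eq_bigr do rewrite lift0 binS natrD scalerDl.
rewrite big_split /= addrA; congr (_ + _).
  rewrite big_ord_recr /= bin_small // scale0r addr0 [RHS]big_ord_recl.
  rewrite bin0 scale1r addn0.
  by congr (_ + _); apply: eq_bigr => i _; rewrite lift0.
by apply: eq_bigr => i _; rewrite addnS addSn.
Qed.

(** Reversing the product turns its factors into [- (y - i)]. *)
Lemma genbin_reflect n y : genbin n.+1 (- y + n%:R) = (-1) ^+ n.+1 * genbin n.+1 y.
Proof.
rewrite /genbin -scalerAr (reindex_inj rev_ord_inj) /=; congr (_ *: _).
rewrite -[X in (-1) ^+ X]card_ord -prodrN; apply: eq_bigr => i _.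
by have i_le := ltn_ord i; rewrite subSS natrB //; ring.
Qed.

Lemma logcoef_inversion n j :
  (-1) ^+ n.+1 * logcoef n.+1 j =
  \sum_(i < n.+1) 'C(n, i)%:R * ((-1) ^+ j * logcoef i.+1 j).
Proof.
transitivity (genbin n.+1 (-1 *: 'X + n%:R))`_j.
  rewrite scaleN1r genbin_reflect coef_signM -['X]scale1r coef_genbin.
  by rewrite expr1n mul1r.
(* Vandermonde at offset 1 and [y = - 'X]. *)
rewrite -add1n -genbin_vandermonde coef_sum.
by apply: eq_bigr => i _; rewrite coefZ add1n coef_genbin.
Qed.

Lemma logcoef_small n j : (n < j)%N -> logcoef n j = 0.
Proof.
elim: n j => [|n IH] [|j] // nj; first exact: logcoef0S.
apply: (mulfI (natrS_neq0 n)).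
by rewrite logcoefS !IH ?mulr0 ?subrr // ltnW.
Qed.

(** Arbitrary weights [w] let this one statement give both identities; [phi] will be the embedding
    of the reals into the complex numbers. *)
Lemma logcoef_weighted_inversion (K : fieldType) (phi : {rmorphism F -> K}) (q : F)
    (w : nat -> K) n : (0 < n)%N ->
  (-1) ^+ n * \sum_(0 <= j < n.+1) phi (logcoef n j * q ^+ (n - j)) * w j =
  \sum_(1 <= i < n.+1) phi q ^+ (n - i) * 'C(n.-1, i.-1)%:R *
    \sum_(0 <= j < i.+1) phi (logcoef i j * q ^+ (i - j)) * ((-1) ^+ j * w j).
Proof.
case: n => // n _; rewrite big_add1 big_mkord /=.
(* All inner sums get the common range [j <= n.+1], which allows the exchange; the added terms
   vanish by [logcoef_small]. *)
transitivity (\sum_(i < n.+1) \sum_(0 <= j < n.+2)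
   phi (q ^+ (n.+1 - j) * ('C(n, i)%:R * ((-1) ^+ j * logcoef i.+1 j))) * w j).
  rewrite mulr_sumr exchange_big /=; apply: eq_bigr => j _.
  rewrite -mulr_suml -rmorph_sum -mulr_sumr -logcoef_inversion.
  by rewrite mulrA -(rmorphN1 phi) -rmorphXn -rmorphM; congr (phi _ * _); ring.
apply: eq_bigr => -[i /= i_le] _; rewrite mulr_sumr.
rewrite (big_cat_nat (n := i.+2)) //= [X in _ + X]big_nat [X in _ + X]big1 ?addr0.
  rewrite !big_nat; apply: eq_bigr => j /andP[_]; rewrite ltnS => ji.
  (* With truncated subtraction this splitting of the exponent of [q] relies on [j <= i.+1]. *)
  have -> : (n.+1 - j = (n - i) + (i.+1 - j))%N.
    by rewrite addnBA // addnS subnK.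
  rewrite exprD !rmorphM !rmorphXn rmorph_nat rmorphN1 subSS; ring.
by move=> j /andP[ij _]; rewrite logcoef_small // !mulr0 rmorph0 mul0r.
Qed.

End StirlingGeneratingPolynomial.

Theorem theorem5 (R : realType) (k : nat) (a q : R) (L : k.-tuple R)
    (b : int) (n m : nat)
    (hk : (1 <= k)%N) (ha : a != 0) (hq : q != 0)
    (hL : forall i : 'I_k, tnth L i != 0)
    (haj : forall j : nat, a + j%:R != 0)
    (hn : (1 <= n)%N) :
  (-1) ^+ n * (polyCauchy1 b a q L n m / n`!%:R)
    = \sum_(1 <= i < n.+1)
        q%:C ^+ (n - i) * 'C(n.-1, i.-1)%:R * (polyCauchy2 b a q L i m / i`!%:R)
  /\
  (-1) ^+ n * (polyCauchy2 b a q L n m / n`!%:R)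
    = \sum_(1 <= i < n.+1)
        q%:C ^+ (n - i) * 'C(n.-1, i.-1)%:R * (polyCauchy1 b a q L i m / i`!%:R).
Proof.
(* Neither [A] nor [w] depends on the first index of the poly-Cauchy numbers, so the inversion
   applies with [w] as weights. *)
pose A : R[i] := ((a + m%:R) ^+ k / a ^+ k)%:C.
pose w i : R[i] := cpow b (lprod L) a * (lprod L)%:C ^+ i
  / ((a + i%:R + m%:R) ^+ k)%:C.
have E1 i : polyCauchy1 b a q L i m / i`!%:R = A *
    \sum_(0 <= j < i.+1) (logcoef R i j * q ^+ (i - j))%:C * w j.
  rewrite /polyCauchy1 -mulrA; congr (_ * _); rewrite mulr_suml.
  apply: eq_bigr => j _; rewrite /logcoef /w !rmorphM fmorphV rmorph_nat; ring.
have E2 i : polyCauchy2 b a q L i m / i`!%:R = A *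
    \sum_(0 <= j < i.+1) (logcoef R i j * q ^+ (i - j))%:C * ((-1) ^+ j * w j).
  rewrite /polyCauchy2 -mulrA; congr (_ * _); rewrite mulr_suml.
  apply: eq_bigr => j _.
  rewrite /logcoef /w !rmorphM fmorphV rmorph_nat rmorph_sign; ring.
have weighted := @logcoef_weighted_inversion R R[i] (real_complex R) q.
split.
  under [RHS]eq_bigr do rewrite E2 mulrCA.
  by rewrite E1 mulrCA -[RHS]mulr_sumr; congr (_ * _); apply: weighted.
under [RHS]eq_bigr do rewrite E1 mulrCA.
rewrite E2 mulrCA -[RHS]mulr_sumr; congr (_ * _).
(* The same inversion with alternating weights: on the right the two signs cancel, leaving the
   numbers of the first kind. *)
rewrite (weighted (fun j => (-1) ^+ j * w j)) //.
apply: eq_bigr => i _; congr (_ * _); apply: eq_bigr => j _.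
by rewrite signrMK.
Qed.
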